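(* Let $\mathbf A=(A,\le,\cdot,\sim,-)$ be a locally integral ipo-semigroup, with set of positive elements $A^+$, integral components $\mathbf A_p$ ($p\in A^+$), and associated family $\Phi=\{\varphi_{pq}:\mathbf A_p\to\mathbf A_q : p\le q \text{ in } A^+\}$ of monoid homomorphisms, $\varphi_{pq}(x)=qx$. Then the Płonka sum $\big(\biguplus_{p\in A^+}A_p,\cdot^{\mathbf S}\big)$ of $\Phi$ is the semigroup reduct of $\mathbf A$, where $x\cdot^{\mathbf S}y=\varphi_{pr}(x)\cdot^{\mathbf A_r}\varphi_{qr}(y)$ for $x\in A_p$, $y\in A_q$ and $r=pq$. Moreover, if we define $\sim^{\mathbf S}x=\sim^{\mathbf A_p}x$ and $-^{\mathbf S}x=-^{\mathbf A_p}x$ for every $p\in A^+$ and $x\in A_p$, and $$x\le^{\mathbf S}y\iff x\cdot^{\mathbf S}\sim^{\mathbf S}y=0_{pq},\quad\text{for all }p,q\in A^+,\ x\in A_p,\ y\in A_q,$$ then the structure $\mathbf S=\big(\biguplus A_p,\le^{\mathbf S},\cdot^{\mathbf S},\sim^{\mathbf S},-^{\mathbf S}\big)$ is $\mathbf A$. Furthermore, cyclicity and commutativity are local properties: $\mathbf A$ is cyclic (respectively, commutative) if and only if all its integral components are cyclic (respectively, commutative).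
   Context: An ipo-semigroup is a structure $\mathbf A=(A,\le,\cdot,\sim,-)$ where $(A,\le)$ is a poset, $(A,\cdot)$ is a semigroup, and $\sim,-$ are order-reversing unary operations with $\sim{-}x=x=-{\sim}x$ and $xy\le z\iff y\cdot{\sim}z\le{\sim}x\iff -z\cdot x\le -y$ for all $x,y,z$. Its product is residuated, with residuals $z/y=-(y\cdot{\sim}z)$ and $x\backslash z={\sim}(-z\cdot x)$, i.e. $xy\le z\iff x\le z/y\iff y\le x\backslash z$. An element $p$ is positive if $x\le px$ for all $x\in A$ (equivalently $x\le xp$ for all $x$); $A^+$ is the set of positive elements. $\mathbf A$ is locally integral if for all $x,y\in A$: $x\backslash x=x/x$ (this element is denoted $1_x$), $1_x\cdot x=x$, $y\le 1_xy$, $x\le 1_x$, and $x\backslash 1_x=1_x$. In that case $-x\cdot x=x\cdot{\sim}x$ for all $x$, and this element is denoted $0_x$. Facts/notation for locally integral $\mathbf A$: $(A^+,\cdot)$ is a join-semilattice whose order is the restriction of $\le$. For $p\in A^+$, $A_p=\{y\in A:1_y=1_p\}$; the sets $A_p$, $p\in A^+$, are pairwise distinct and partition $A$ (so the disjoint union $\biguplus A_p$ is just $A$). The integral component $\mathbf A_p=(A_p,\le,\cdot,1_p,\sim,-)$ carries the restrictions of the relation and operations of $\mathbf A$ and is an integral ipo-monoid (an ipo-semigroup with an element $1_p$ that is an identity for the product and the top element). For $p\le q$ in $A^+$, the map $\varphi_{pq}:A_p\to A_q$, $\varphi_{pq}(x)=qx$, is a well-defined monoid homomorphism, $\varphi_{pp}=\mathrm{id}$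 and $\varphi_{qr}\varphi_{pq}=\varphi_{pr}$ for $p\le q\le r$. An ipo-semigroup (or ipo-monoid) is cyclic if ${\sim}x=-x$ for all $x$, and commutative if its product is commutative. *)

(* Defs.v *)
From HB Require Import structures.
From mathcomp Require Import all_boot all_order.
From mathcomp Require Import boolp.

Set Implicit Arguments.
Unset Strict Implicit.
Unset Printing Implicit Defensive.

Import Order.TTheory.
Local Open Scope order_scope.
Local Open Scope group_scope.

HB.mixin Record POrder_Semigroup_isIpoSemigroup d A
    of Order.POrder d A & Semigroup A := {
  tilde : A -> A;
  minus : A -> A;
  tilde_antitone : forall x y : A, x <= y -> tilde y <= tilde x;
  minus_antitone : forall x y : A, x <= y -> minus y <= minus x;
  minusK : forall x, tilde (minus x) = x;
  tildeK : forall x, minus (tilde x) = x;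
  tilde_rotate : forall x y z : A, (x * y <= z) = (y * tilde z <= tilde x);
  minus_rotate : forall x y z : A, (x * y <= z) = (minus z * x <= minus y)
}.

#[short(type="ipoSemigroupType")]
HB.structure Definition IpoSemigroup d :=
  {A of POrder_Semigroup_isIpoSemigroup d A & Order.POrder d A & Semigroup A}.

Notation "∼ x" := (tilde x) (at level 35, right associativity) : group_scope.
Notation "- x" := (minus x) : group_scope.

Section IpoSemigroupDefs.
Context {d : Order.disp_t} {A : ipoSemigroupType d}.
Implicit Types x y z : A.

(* [rres z y] is z / y and [lres x z] is x \ z. *)
Definition rres z y : A := - (y * ∼ z).
Definition lres x z : A := ∼ (- z * x).

Definition positive (p : A) : Prop := forall x, x <= p * x.

End IpoSemigroupDefs.

Definition cyclic d (A : ipoSemigroupType d) : Prop := forall x : A, ∼ x = - x.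

Definition commutative_product d (A : ipoSemigroupType d) : Prop :=
  forall x y : A, x * y = y * x.

HB.mixin Record IpoSemigroup_Monoid_isIntegral d A
    of IpoSemigroup d A & Monoid A := {
  le_one : forall x : A, x <= 1
}.

#[short(type="integralIpoMonoidType")]
HB.structure Definition IntegralIpoMonoid d :=
  {A of IpoSemigroup_Monoid_isIntegral d A & IpoSemigroup d A & Monoid A}.

HB.mixin Record IpoSemigroup_isLocallyIntegral d A of IpoSemigroup d A := {
  lres_rres : forall x : A, lres x x = rres x x;
  lres_mul : forall x : A, lres x x * x = x;
  le_lres_mul : forall x y : A, y <= lres x x * y;
  le_lres : forall x : A, x <= lres x x;
  lres_lres : forall x : A, lres x (lres x x) = lres x x
}.

#[short(type="locallyIntegralType")]
HB.structure Definition LocallyIntegral d :=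
  {A of IpoSemigroup_isLocallyIntegral d A & IpoSemigroup d A}.

(* [lone x] is 1_x and [lzero x] is 0_x; cf. [lzero_tilde]. *)
Definition lone d (A : locallyIntegralType d) (x : A) : A := lres x x.
Definition lzero d (A : locallyIntegralType d) (x : A) : A := - x * x.

Section LocallyIntegralTheory.
Context {d : Order.disp_t} {A : locallyIntegralType d}.
Implicit Types x y z p q r : A.

Lemma rresP x y z : (x * y <= z) = (x <= rres z y).
Proof.
rewrite tilde_rotate; apply/idP/idP => h.
  by rewrite -[x]tildeK; apply: minus_antitone.
by rewrite -[_ * _]minusK; apply: tilde_antitone.
Qed.

Lemma lresP x y z : (x * y <= z) = (y <= lres x z).
Proof.
rewrite minus_rotate; apply/idP/idP => h.
  by rewrite -[y]minusK; apply: tilde_antitone.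
by rewrite -[_ * _]tildeK; apply: minus_antitone.
Qed.

Lemma minus_le x y : (- x <= - y) = (y <= x).
Proof.
apply/idP/idP => [/tilde_antitone|/minus_antitone //].
by rewrite !minusK.
Qed.

Lemma mul_le2l x y z : x <= y -> z * x <= z * y.
Proof. by move=> h; rewrite lresP (le_trans h) // -lresP. Qed.

Lemma mul_le2r x y z : x <= y -> x * z <= y * z.
Proof. by move=> h; rewrite rresP (le_trans h) // -rresP. Qed.

Lemma mul_le2 x y z t : x <= y -> z <= t -> x * z <= y * t.
Proof. by move=> h k; apply: le_trans (mul_le2r _ h) (mul_le2l _ k). Qed.

Lemma positive_mulr p x : positive p -> x <= x * p.
Proof.
move=> pp; rewrite -minus_le.
have : p * ∼ (x * p) <= ∼ x by rewrite -tilde_rotate.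
move=> /(le_trans (pp _)) /minus_antitone.
by rewrite !tildeK minus_le.
Qed.

Lemma minus_mul x : - x * x = - lone x.
Proof. by rewrite /lone /lres tildeK. Qed.

Lemma mul_tilde x : x * ∼ x = ∼ lone x.
Proof. by rewrite /lone lres_rres /rres minusK. Qed.

Lemma lone_mul x : lone x * x = x.
Proof. exact: lres_mul. Qed.

Lemma lone_positive x : positive (lone x).
Proof. by move=> y; apply: le_lres_mul. Qed.

Lemma mul_lone x : x * lone x = x.
Proof.
apply: le_anti; rewrite lresP lexx /=.
exact/positive_mulr/lone_positive.
Qed.

Lemma le_lone x y : (x * y <= x) = (y <= lone x).
Proof. exact: lresP. Qed.

Lemma le_lone_left x y : (y * x <= x) = (y <= lone x).
Proof. by rewrite rresP /lone lres_rres. Qed.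

Lemma lone_pos p : positive p -> lone p = p.
Proof.
move=> pp; apply: le_anti; rewrite le_lres andbT.
by rewrite -[leRHS]lone_mul; apply: positive_mulr.
Qed.

Lemma lone_lone x : lone (lone x) = lone x.
Proof. exact/lone_pos/lone_positive. Qed.

Lemma positive_idem p : positive p -> p * p = p.
Proof. by move=> pp; have := lone_mul p; rewrite lone_pos. Qed.

Lemma positiveM p q : positive p -> positive q -> positive (p * q).
Proof.
by move=> pp pq x; rewrite -mulgA; apply: le_trans (pq x) (pp _).
Qed.

Lemma lone_minus_aux x : lone (- x) = - - lone x.
Proof. by rewrite {1}/lone lres_rres /rres minusK minus_mul. Qed.

Lemma minus_minus_lone x : - - lone x = lone x.
Proof.
have h : - - - - lone x = - - lone x.
  by have := lone_lone (- x); rewrite !lone_minus_aux !lone_lone.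
by have := congr1 (fun y : A => ∼ ∼ y) h; rewrite !minusK.
Qed.

Lemma tilde_lone x : ∼ lone x = - lone x.
Proof. by rewrite -{1}minus_minus_lone minusK. Qed.

Lemma lone_minus x : lone (- x) = lone x.
Proof. by rewrite lone_minus_aux minus_minus_lone. Qed.

Lemma lone_tilde x : lone (∼ x) = lone x.
Proof. by rewrite -{2}[x]tildeK lone_minus. Qed.

Lemma lzero_minus x : lzero x = - lone x.
Proof. exact: minus_mul. Qed.

Lemma lzero_tilde x : lzero x = x * ∼ x.
Proof. by rewrite lzero_minus mul_tilde tilde_lone. Qed.

Lemma lone_lzero x : lone (lzero x) = lone x.
Proof. by rewrite lzero_minus lone_minus lone_lone. Qed.

Lemma minus_lone_mul x : - lone x * x = - lone x.
Proof.
by rewrite -[LHS]tildeK -/(lres x (lone x)) {1}/lone lres_lres -/(lone x).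
Qed.

Lemma lone_le_of_absorb p r : positive p -> - p * r = - p -> r <= p.
Proof.
by move=> pp h; rewrite -{1}(lone_pos pp) -lone_minus -le_lone h.
Qed.

Lemma loneM x y : lone x = lone y -> lone (x * y) = lone x.
Proof.
move=> exy; apply: le_anti; apply/andP; split; last first.
  by rewrite -le_lone_left mulgA lone_mul.
apply: lone_le_of_absorb; first exact: lone_positive.
have h : - lone x * (x * y) = - lone x.
  by rewrite mulgA minus_lone_mul exy minus_lone_mul.
by rewrite -[in LHS]h -mulgA mul_lone h.
Qed.

Lemma minus_mul_of_le x q : positive q -> lone x <= q -> - q * x = - q.
Proof.
move=> qq; set p := lone x => pq.
have pp : positive p := lone_positive x.
have lq : lone q = q := lone_pos qq.
have qqq : q * q = q := positive_idem qq.
set y := lres x q.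
have xy : x * y <= q by rewrite lresP.
have qy : q <= y.
  by rewrite -lresP -[leRHS]qqq mul_le2r // (le_trans (le_lres x) pq).
have yy : y * y = y.
  apply: positive_idem => a; apply: le_trans (qq a) _; exact: mul_le2r.
set t := - p * q.
have pyt : - p * y = t.
  apply: le_anti; apply/andP; split; last exact: mul_le2l.
  by rewrite -[X in X * y]minus_lone_mul -mulgA mul_le2l.
have ty : y <= lone t by rewrite -le_lone -pyt -mulgA yy.
set w := lres q p.
have lw : lone w = lone t by rewrite lone_tilde.
have wq : w <= q.
  apply: le_trans pq; apply: le_trans (qq w) _; by rewrite lresP.
have tq : t <= q.
  rewrite -[leRHS]qqq mul_le2r // (le_trans _ pq) //.
  by rewrite (le_trans (le_lres _)) // -/(lone _) lone_minus lone_pos.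
have qw : - q <= w by rewrite -{1}lq -tilde_lone lq tilde_antitone.
have mqq : - q * - q = - q.
  by have := minus_lone_mul (- q); rewrite lone_minus lq.
have mqw : - q * w = - q.
  apply: le_anti; apply/andP; split; last by rewrite -{1}mqq mul_le2l.
  by rewrite (le_trans (mul_le2l _ wq)) // -{2}lq -lone_minus mul_lone.
have uq : lone t <= q.
  apply: lone_le_of_absorb => //.
  by rewrite -{1}mqw -mulgA -lw mul_lone mqw.
have yq : y = q by apply: le_anti; rewrite qy (le_trans ty uq).
by rewrite -[in RHS]yq /y /lres tildeK.
Qed.

Lemma lone_mul_pos x q : positive q -> lone x <= q -> lone (q * x) = q.
Proof.
move=> qq xq; apply: le_anti; apply/andP; split; last first.
  by rewrite -le_lone_left mulgA positive_idem.
have h : - q * (q * x) = - q.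
  by rewrite mulgA -{2}(lone_pos qq) -lone_minus mul_lone minus_mul_of_le.
apply: lone_le_of_absorb => //.
by rewrite -[in LHS]h -mulgA mul_lone h.
Qed.

Lemma positiveM_le p q r :
  positive p -> positive q -> positive r ->
  (p * q <= r) = (p <= r) && (q <= r).
Proof.
move=> pp qq rr; apply/idP/andP => [h|[pr qr]].
  by split; apply: le_trans h; [apply: positive_mulr | apply: pp].
by rewrite -[leRHS](positive_idem rr) mul_le2.
Qed.

End LocallyIntegralTheory.

Record positives d (A : locallyIntegralType d) := Positive {
  positive_val :> A;
  positive_valP : `[< positive positive_val >]
}.

Section Positives.
Context {d : Order.disp_t} {A : locallyIntegralType d}.

HB.instance Definition _ := [isSub for @positive_val d A].
HB.instance Definition _ := [Choice of positives A by <:].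
HB.instance Definition _ :=
  [SubChoice_isSubPOrder of positives A by <: with d].

Implicit Types p q r : positives A.

Lemma positiveP p : positive (p : A).
Proof. exact/asboolP/positive_valP. Qed.

Definition positive_mul p q : positives A :=
  Positive (asboolT (positiveM (positiveP p) (positiveP q))).

Lemma positive_mul_le p q r : (positive_mul p q <= r) = (p <= r) && (q <= r).
Proof. by apply: positiveM_le; apply: positiveP. Qed.

(* The join of [p] and [q] is [positive_mul p q], their product in [A]. *)
HB.instance Definition _ :=
  Order.POrder_isJoinSemilattice.Build d (positives A) positive_mul_le.

End Positives.

Record component d (A : locallyIntegralType d) (p : positives A) := Component {
  component_val :> A;
  component_valP : lone component_val == lone (p : A)
}.

Section Components.
Context {d : Order.disp_t} {A : locallyIntegralType d}.

Section OneComponent.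
Context {p : positives A}.

HB.instance Definition _ := [isSub for @component_val d A p].
HB.instance Definition _ := [Choice of component p by <:].
HB.instance Definition _ :=
  [SubChoice_isSubPOrder of component p by <: with d].

Implicit Types x y z : component p.

Lemma loneE x : lone (x : A) = lone (p : A).
Proof. exact/eqP/component_valP. Qed.

Fact component_mul_subproof x y : lone ((x : A) * (y : A)) == lone (p : A).
Proof. by rewrite loneM !loneE. Qed.

Fact component_tilde_subproof x : lone (∼ (x : A)) == lone (p : A).
Proof. by rewrite lone_tilde loneE. Qed.

Fact component_minus_subproof x : lone (- (x : A)) == lone (p : A).
Proof. by rewrite lone_minus loneE. Qed.

Fact component_one_subproof : lone (lone (p : A)) == lone (p : A).
Proof. by rewrite lone_lone. Qed.

Fact component_zero_subproof : lone (lzero (p : A)) == lone (p : A).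
Proof. by rewrite lone_lzero. Qed.

Definition component_mul x y := Component (component_mul_subproof x y).
Definition component_tilde x := Component (component_tilde_subproof x).
Definition component_minus x := Component (component_minus_subproof x).
Definition component_one := Component component_one_subproof.
Definition component_zero := Component component_zero_subproof.

Fact component_mulA : associative component_mul.
Proof. by move=> x y z; apply: val_inj; apply: mulgA. Qed.

Fact component_mul1 : left_id component_one component_mul.
Proof. by move=> x; apply: val_inj; rewrite /= -(loneE x) lone_mul. Qed.

Fact component_mulr1 : right_id component_one component_mul.
Proof. by move=> x; apply: val_inj; rewrite /= -(loneE x) mul_lone. Qed.

HB.instance Definition _ := isMonoid.Build (component p)
  component_mulA component_mul1 component_mulr1.

Fact component_tilde_antitone x y :
  x <= y -> component_tilde y <= component_tilde x.
Proof. exact: (@tilde_antitone _ A). Qed.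

Fact component_minus_antitone x y :
  x <= y -> component_minus y <= component_minus x.
Proof. exact: (@minus_antitone _ A). Qed.

Fact component_minusK x : component_tilde (component_minus x) = x.
Proof. by apply: val_inj; apply: minusK. Qed.

Fact component_tildeK x : component_minus (component_tilde x) = x.
Proof. by apply: val_inj; apply: tildeK. Qed.

Fact component_tilde_rotate x y z :
  (x * y <= z) = (y * component_tilde z <= component_tilde x).
Proof. exact: (@tilde_rotate _ A). Qed.

Fact component_minus_rotate x y z :
  (x * y <= z) = (component_minus z * x <= component_minus y).
Proof. exact: (@minus_rotate _ A). Qed.

HB.instance Definition _ := POrder_Semigroup_isIpoSemigroup.Build d (component p)
  component_tilde_antitone component_minus_antitone component_minusK
  component_tildeK component_tilde_rotate component_minus_rotate.

Fact component_le_one x : x <= 1.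
Proof.
by change ((x : A) <= lone (p : A)); rewrite -(loneE x); apply: le_lres.
Qed.

HB.instance Definition _ :=
  IpoSemigroup_Monoid_isIntegral.Build d (component p) component_le_one.

End OneComponent.

Fact phi_subproof (p q : positives A) (pq : p <= q) (x : component p) :
  lone ((q : A) * (x : A)) == lone (q : A).
Proof.
have qq := positiveP q; rewrite lone_mul_pos ?(lone_pos qq) //.
by rewrite (loneE x) (lone_pos (positiveP p)).
Qed.

Definition phi (p q : positives A) (pq : p <= q) (x : component p) :
  component q := Component (phi_subproof pq x).

Fact phi_morphism (p q : positives A) (pq : p <= q) : monoid_morphism (phi pq).
Proof.
split=> [|x y]; apply: val_inj => /=.
  rewrite !(lone_pos (positiveP _)).
  apply: le_anti; rewrite positiveM_le ?lexx ?[_ <= _]pq //=; try exact: positiveP.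
  exact/positive_mulr/positiveP.
have h : (q : A) * (x : A) * (q : A) = (q : A) * (x : A).
  have := mul_lone ((q : A) * (x : A)).
  by rewrite (eqP (phi_subproof pq x)) (lone_pos (positiveP q)).
by rewrite [RHS]mulgA h mulgA.
Qed.

HB.instance Definition _ (p q : positives A) (pq : p <= q) :=
  isUMagmaMorphism.Build (component p) (component q) (phi pq) (phi_morphism pq).

End Components.

Record directed_system d (I : joinSemilatticeType d) (M : I -> monoidType) :=
  DirectedSystem {
  trans : forall i j : I, i <= j -> UMagmaMorphism.type (M i) (M j);
  trans_id : forall (i : I) (ii : i <= i) (x : M i), trans ii x = x;
  trans_comp : forall (i j k : I) (ij : i <= j) (jk : j <= k) (ik : i <= k)
    (x : M i), trans jk (trans ij x) = trans ik x
}.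

Definition plonka_mul d (I : joinSemilatticeType d) (M : I -> monoidType)
    (Phi : directed_system M) (u v : {i : I & M i}) : {i : I & M i} :=
  Tagged M (trans Phi (leUl (tag u) (tag v)) (tagged u) *
            trans Phi (leUr (tag v) (tag u)) (tagged v)).

Section ComponentSum.
Context {d : Order.disp_t} (A : locallyIntegralType d).

Fact phi_id (p : positives A) (pp : p <= p) (x : component p) : phi pp x = x.
Proof.
apply: val_inj => /=.
by rewrite -{1}(lone_pos (positiveP p)) -(loneE x) lone_mul.
Qed.

Fact phi_comp (p q r : positives A) (pq : p <= q) (qr : q <= r) (pr : p <= r)
  (x : component p) : phi qr (phi pq x) = phi pr x.
Proof.
apply: val_inj; rewrite /= mulgA; congr (_ * _).
have [qq rr] := (positiveP q, positiveP r).
apply: le_anti; rewrite positiveM_le // lexx [_ <= _]qr /=.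
exact: positive_mulr.
Qed.

Definition Phi : directed_system (@component d A) :=
  @DirectedSystem d (positives A) (@component d A)
    (fun p q pq => phi pq) phi_id phi_comp.

Definition sum_carrier := {p : positives A & component p}.

Definition sum_mul (u v : sum_carrier) : sum_carrier := plonka_mul Phi u v.

Definition sum_tilde (u : sum_carrier) : sum_carrier :=
  Tagged (@component d A) (∼ tagged u).

Definition sum_minus (u : sum_carrier) : sum_carrier :=
  Tagged (@component d A) (- tagged u).

Definition sum_le (u v : sum_carrier) : Prop :=
  sum_mul u (sum_tilde v) =
  Tagged (@component d A) (component_zero (p := positive_mul (tag u) (tag v))).

(* The components partition [A]; this map identifies their disjoint union
   with [A]. *)
Definition sum_val (u : sum_carrier) : A := tagged u.

End ComponentSum.

(* Main.v *)
Require Import Defs.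
From HB Require Import structures.
From mathcomp Require Import all_boot all_order.
From mathcomp Require Import boolp.
Import Order.TTheory.
Local Open Scope order_scope.
Local Open Scope group_scope.

(** If [q] is positive and [1_x <= q], then both [qx] and [xq] have local unit
[q], so [qx = qxq = xq].  Hence, for [r = 1_x 1_y], we get
[(rx)(ry) = x r y = (x 1_x)(1_y y) = xy].  For the order, [x <= y] is equivalent
to [rx <= y], that is, to [x * ∼ y <= ∼ r = 0_r]; as [x * ∼ y] lies in [A_r],
whose bottom is [0_r], this inequality is an equality. *)

Section LocallyIntegral.
Context {d : Order.disp_t} {A : locallyIntegralType d}.
Implicit Types x y p q : A.

(** By [positiveM_le], both products are the join of [p] and [q] among the positive elements. *)
Lemma positive_mulC p q : positive p -> positive q -> p * q = q * p.
Proof.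
move=> pp qq; have [pq qp] := (positiveM pp qq, positiveM qq pp).
apply: le_anti.
by rewrite !positiveM_le // (pp q) (qq p) !positive_mulr.
Qed.

(** Mirror image of [lone_mul_pos]: [- q] absorbs [x * q], hence also its local unit, which is
    therefore at most [q]. *)
Lemma lone_mul_pos_right x q : positive q -> lone x <= q -> lone (x * q) = q.
Proof.
move=> qq xq; apply: le_anti; apply/andP; split; last first.
  by rewrite -le_lone -mulgA positive_idem.
have h : - q * (x * q) = - q.
  by rewrite mulgA minus_mul_of_le // -{2}(lone_pos qq) -lone_minus mul_lone.
apply: lone_le_of_absorb => //.
by rewrite -[in LHS]h -mulgA mul_lone h.
Qed.

Lemma positive_comm x q : positive q -> lone x <= q -> q * x = x * q.
Proof.
move=> qq xq; have := mul_lone (q * x); rewrite lone_mul_pos // => <-.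
by have := lone_mul (x * q); rewrite lone_mul_pos_right // mulgA.
Qed.

Lemma plonka_mulE x y :
  (lone x * lone y * x) * (lone x * lone y * y) = x * y.
Proof.
have [px py] := (lone_positive x, lone_positive y).
have pr := positiveM px py.
rewrite (positive_comm _ _ pr (positive_mulr _ py)).
rewrite -[LHS]mulgA [_ * (_ * y)]mulgA positive_idem //.
by rewrite -(mulgA (lone x)) lone_mul mulgA mul_lone.
Qed.

(** [plonka_mulE] writes [x * y] as a product of two elements of local unit [lone x * lone y], and
    [loneM] keeps that unit. *)
Lemma lone_prod x y : lone (x * y) = lone x * lone y.
Proof.
have [px py] := (lone_positive x, lone_positive y).
have pr := positiveM px py.
have rx : lone (lone x * lone y * x) = lone x * lone y.
  by apply: lone_mul_pos => //; apply: positive_mulr.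
have ry : lone (lone x * lone y * y) = lone x * lone y.
  by apply: lone_mul_pos => //; apply: px.
by rewrite -plonka_mulE loneM rx // ry.
Qed.

(** Image of [∼ x <= 1_x] under [-]: the element 0_x is the bottom of the component of [x]. *)
Lemma minus_lone_le x : - lone x <= x.
Proof.
by rewrite -[leRHS]tildeK minus_antitone // -lone_tilde; apply: le_lres.
Qed.

Lemma le_lzeroE x y : x <= y <-> x * ∼ y = lzero (lone x * lone y).
Proof.
have [px py] := (lone_positive x, lone_positive y).
have pr := positiveM px py.
have -> : lzero (lone x * lone y) = - (lone x * lone y).
  by rewrite lzero_minus lone_pos.
split=> [xy|h].
  apply: le_anti; apply/andP; split; last first.
    by rewrite -[in leLHS](lone_tilde y) -lone_prod minus_lone_le.
  (* With r = 1_x 1_y and [- r = ∼ r], rotation turns the goal into [r * x <= y]; swapping the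
     factors of r lets [x] absorb 1_x. *)
  rewrite -[in leRHS](lone_pos pr) -tilde_lone lone_pos // -tilde_rotate.
  rewrite positive_mulC // -mulgA lone_mul -[leRHS]lone_mul.
  exact: mul_le2l.
(* Here [1_x * x <= y] is rotated instead, which leaves 1_x <= r. *)
rewrite -[leLHS]lone_mul tilde_rotate h tilde_lone minus_le.
exact: positive_mulr.
Qed.

End LocallyIntegral.

Section ComponentSumTheory.
Context {d : Order.disp_t} {A : locallyIntegralType d}.
Implicit Types (x : A) (p : positives A) (u v : sum_carrier A).

Lemma component_lone p (x : component p) : lone (x : A) = p.
Proof. by rewrite loneE lone_pos //; apply: positiveP. Qed.

Definition local_unit x : positives A := Positive (asboolT (lone_positive x)).

Fact local_unit_subproof x y (xy : lone x = lone y) :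
  lone x == lone (local_unit y : A).
Proof. by rewrite /= lone_lone xy. Qed.

(** The explicit equation lets elements whose local units are only provably equal share one
    component type. *)
Definition to_component x y (xy : lone x = lone y) : component (local_unit y) :=
  Component (local_unit_subproof x y xy).

(** The index is recovered from the element as its local unit. *)
Lemma sum_val_inj : injective (@sum_val d A).
Proof.
move=> [p x] [q y]; rewrite /sum_val /= => xy.
have pq : p = q.
  by apply: val_inj; rewrite /= -(component_lone p x) -(component_lone q y) xy.
by case: q / pq y xy => y /val_inj ->.
Qed.

Lemma sum_val_bij : bijective (@sum_val d A).
Proof.
pose f x : sum_carrier A := Tagged (@component d A) (to_component x x erefl).
have fK : cancel f (@sum_val d A) by [].
by exists f => //; apply: inj_can_sym sum_val_inj.
Qed.

Lemma sum_val_mul u v : sum_val (sum_mul u v) = sum_val u * sum_val v.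
Proof.
case: u v => [p x] [q y]; rewrite /sum_val /=.
by rewrite -[RHS]plonka_mulE !component_lone.
Qed.

(** Injectivity of [sum_val] lets the tagged equation behind [sum_le] be tested in [A]. *)
Lemma sum_leE u v : sum_le u v <-> sum_val u <= sum_val v.
Proof.
rewrite le_lzeroE -[∼ sum_val v]/(sum_val (sum_tilde v)) -sum_val_mul.
case: u v => [p x] [q y].
rewrite [sum_val (existT _ p x)]/sum_val [sum_val (existT _ q y)]/sum_val /=.
rewrite !component_lone /sum_le.
by split=> [->|h] //; apply: sum_val_inj.
Qed.

Lemma cyclic_local : cyclic A <-> forall p : positives A, cyclic (component p).
Proof.
split=> [cA p x|cC x]; first exact/val_inj/cA.
have := cC _ (to_component x x erefl).
exact: (congr1 (@component_val d A _)).
Qed.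

(** For r = 1_x 1_y, [plonka_mulE] gives [x * y] and [y * x] as the two products of [r * x] and
    [r * y], which lie in one component. *)
Lemma commutative_local : commutative_product A <->
  forall p : positives A, commutative_product (component p).
Proof.
split=> [cA p x y|cC x y]; first exact/val_inj/cA.
have [px py] := (lone_positive x, lone_positive y).
have pr := positiveM px py.
have rx : lone (lone x * lone y * x) = lone (x * y).
  by rewrite [RHS]lone_prod lone_mul_pos //; apply: positive_mulr.
have ry : lone (lone x * lone y * y) = lone (x * y).
  by rewrite [RHS]lone_prod lone_mul_pos //; apply: px.
rewrite -plonka_mulE -(plonka_mulE y) (positive_mulC _ _ py px).
have := cC _ (to_component _ _ rx) (to_component _ _ ry).
exact: (congr1 (@component_val d A _)).
Qed.

End ComponentSumTheory.

Theorem theorem3p19 (d : Order.disp_t) (A : locallyIntegralType d) :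
  [/\ bijective (@sum_val d A),
      forall u v : sum_carrier A, sum_val (sum_mul u v) = sum_val u * sum_val v,
      forall u : sum_carrier A, sum_val (sum_tilde u) = ∼ sum_val u,
      forall u : sum_carrier A, sum_val (sum_minus u) = - sum_val u &
      forall u v : sum_carrier A, sum_le u v <-> sum_val u <= sum_val v] /\
  (cyclic A <-> forall p : positives A, cyclic (component p)) /\
  (commutative_product A <->
     forall p : positives A, commutative_product (component p)).
Proof.
split; last by split; [apply: cyclic_local|apply: commutative_local].
split=> //; [exact: sum_val_bij|exact: sum_val_mul|exact: sum_leE].
Qed.
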